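(* For the $4\times4\times4$ cube, $P_4=4$.
   Context: For a positive integer $n$, an initial state of the $n\times n\times n$ cube of lights is an array $A=(A_{ijk})_{0\le i,j,k\le n-1}$ with entries $A_{ijk}\in\{+1,-1\}$ ($+1$ for on, $-1$ for off). There are $3n$ plane switches $x_i,y_j,z_k$ ($0\le i,j,k\le n-1$): switch $x_i$ flips (changes the sign of) all lights $A_{ijk}$ with first coordinate $i$, switch $y_j$ flips all lights with second coordinate $j$, and switch $z_k$ flips all lights with third coordinate $k$. The imbalance of a state is the absolute difference between the number of lights on and the number of lights off. Writing $x_i,y_j,z_k=-1$ if the corresponding switch is thrown and $+1$ otherwise, the imbalance after throwing the switches is $\big|\sum_{i,j,k}x_iy_jz_kA_{ijk}\big|$. The number $P_n$ is defined as the minimum value such that for every initial state $A$ of the $n\times n\times n$ cube there exist $x,y,z\in\{\pm1\}^n$ with $\big|\sum_{i,j,k}x_iy_jz_kA_{ijk}\big|\le P_n$. *)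

(* Defs.v *)
From mathcomp Require Import all_boot all_order all_algebra.

Set Implicit Arguments.
Unset Strict Implicit.
Unset Printing Implicit Defensive.

Import Order.TTheory GRing.Theory Num.Theory.

Local Open Scope ring_scope.

(* The two-element type {+1, -1}, as a finite subtype of int.  For a light, +1
   is on and -1 is off; for a switch, -1 is thrown and +1 is not thrown. *)
Definition pm1 : finType := seq_sub [:: 1 : int; -1].

Definition state (n : nat) : finType := {ffun 'I_n * 'I_n * 'I_n -> pm1}.

Definition switches (n : nat) : finType := {ffun 'I_n -> pm1}.

(* (number of lights on) - (number of lights off) is the sum of the entries, and
   light (i, j, k) shows x_i y_j z_k A_ijk after the switches x, y, z. *)
Definition imbalance (n : nat) (A : state n) (x y z : switches n) : nat :=
  absz (\sum_(i < n) \sum_(j < n) \sum_(k < n)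
      val (x i) * val (y j) * val (z k) * val (A (i, j, k))).

Definition attainable (n p : nat) : bool :=
  [forall A : state n, exists x : switches n, exists y : switches n,
     exists z : switches n, (imbalance A x y z <= p)%N].

Lemma attainable_exists (n : nat) : exists p : nat, attainable n p.
Proof.
have s1 : (1 : int) \in [:: 1 : int; -1] by [].
pose e : switches n := [ffun=> SeqSub s1 : pm1].
exists (\max_(A : state n) imbalance A e e e)%N.
apply/forallP=> A; do 3 (apply/existsP; exists e).
exact: (@leq_bigmax _ (fun A : state n => imbalance A e e e)).
Qed.

Definition P (n : nat) : nat := ex_minn (attainable_exists n).

(* Main.v *)
Require Import Defs.
From mathcomp Require Import all_boot all_order all_algebra.
From mathcomp Require Import ring zify.

(** An averaging argument leaves few sums that could resist balancing, and parity
rules these out; parity also gives the lower bound.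

Upper bound.  Throwing the switches z collapses every line (i, j, _) to an even
number 2 C_ij with |C_ij| <= 2, and it remains to find x, y with
|sum x_i y_j C_ij| <= 2.  As z runs through a coset of the four rows of a
Hadamard matrix, Parseval's identity gives the sum of the C_ij^2 the mean 16, so
some z has sum at most 16.  Moreover the parity of C_ij is the same throughout
the coset and is reversed by throwing one more switch, so a coset can be chosen
in which at least 8 of the 16 entries are odd ([balance_bits]).

Fix such a C.  By Parseval again, some y makes the row sums r_i satisfy
sum r_i^2 <= 16.  Four integers with this property can be signed to a total of
absolute value at most 2, except when three vanish and the fourth is 3 or 4 in
absolute value ([balance_or_concentrated]).  Since sum r_i^2 has the parity of
the sum of the C_ij^2 for every y, only one of the two exceptions can occur for
a given C.
- A single 3: the sum of the C_ij^2 is odd, hence at most 15, and with 8 odd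
  entries this leaves room for at most one entry of absolute value 2.  Some
  column can then be flipped so that every row sum becomes at most 2 in absolute
  value, with sum of squares at most 16 and no exception possible
  ([balance_odd]).
- A single 4: unless balance is possible, no y gives a sum of squares below 16,
  so by Parseval all y give exactly 16 and all row sums are multiples of 4.  But
  flipping the column of an odd entry changes a row sum by 2 modulo 4
  ([balance_even]).

Lower bound.  Let exactly six lights be off, placed so that every switch
controls an even number of them.  A reachable total is
(sum x_i) (sum y_j) (sum z_k) - 2 T, where T is a sum of six signs with product
1.  The first term is divisible by 8 and T is 2 modulo 4, so the total is 4
modulo 8, and its absolute value is at least 4 ([imbalance_hard_state]). *)

Set Implicit Arguments.
Unset Strict Implicit.
Unset Printing Implicit Defensive.

Import Order.TTheory GRing.Theory Num.Theory.

Local Open Scope ring_scope.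

(** * Signed sums and the Hadamard matrix of order 4 *)

(** Switch settings are predicates, a thrown switch being [true], so that
throwing switches one after the other is addition of booleans. *)
Definition dot n (s : 'I_n -> bool) (a : 'I_n -> int) : int :=
  \sum_i (-1) ^+ s i * a i.

Lemma sum4 (R : nmodType) (f : 'I_4 -> R) :
  \sum_i f i = f (inord 0) + f (inord 1) + f (inord 2) + f (inord 3).
Proof.
rewrite !big_ord_recl big_ord0 addr0 !addrA.
by do 4?[congr (_ + _)]; congr f; apply/val_inj; rewrite /= inordK.
Qed.

(** The Sylvester matrix: the sign of entry (k, j) is given by the scalar
product of the binary expansions of k and j. *)
Definition hadamard (k j : 'I_4) : bool :=
  (odd k && odd j) (+) ((1 < k)%N && (1 < j)%N).

Definition coset (u : 'I_4 -> bool) (k j : 'I_4) : bool := u j (+) hadamard k j.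

(** The four sign vectors of a coset are orthogonal, of squared length 4. *)
Lemma parseval (u : 'I_4 -> bool) (a : 'I_4 -> int) :
  \sum_k dot (coset u k) a ^+ 2 = 4 * \sum_j a j ^+ 2.
Proof.
rewrite /dot /coset /hadamard !sum4 !inordK //= !addbF !addbT.
by do 4!case: (u _); rewrite /= ?expr0 ?expr1; ring.
Qed.

Lemma exists_le_mean (f : 'I_4 -> int) (m : int) :
  \sum_k f k <= 4 * m -> exists k, f k <= m.
Proof.
move=> le_f; apply/existsP.
case: (boolP [exists k, f k <= m]) => // /existsPn lt_f.
move: le_f; rewrite sum4.
move: (lt_f (inord 0)) (lt_f (inord 1)) (lt_f (inord 2)) (lt_f (inord 3)).
lia.
Qed.

Lemma dot_sqr_parity (s : 'I_4 -> bool) (a : 'I_4 -> int) :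
  exists q, dot s a ^+ 2 = \sum_j a j ^+ 2 + 2 * q.
Proof.
pose b j := (-1) ^+ s j * a j.
exists (b (inord 0) * (b (inord 1) + b (inord 2) + b (inord 3))
  + b (inord 1) * (b (inord 2) + b (inord 3)) + b (inord 2) * b (inord 3)).
have -> : \sum_j a j ^+ 2 = \sum_j b j ^+ 2.
  by apply: eq_bigr => j _; rewrite exprMn sqrr_sign mul1r.
rewrite /dot -/(b _) !sum4 -/(b _) -/(b _) -/(b _) -/(b _); ring.
Qed.

Definition flip n (s : 'I_n -> bool) (j k : 'I_n) : bool := s k (+) (k == j).

Lemma dot_flip n (s : 'I_n -> bool) (j : 'I_n) (a : 'I_n -> int) :
  dot (flip s j) a = dot s a - 2 * ((-1) ^+ s j * a j).
Proof.
rewrite /dot (bigD1 j) //= [in RHS](bigD1 j) //= /flip eqxx.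
under eq_bigr => k /negPf-> do rewrite addbF.
by rewrite addbT; case: (s j) => /=; rewrite ?expr0 ?expr1; ring.
Qed.

(** * Balancing four integers with sum of squares at most 16 *)

(** Sequences are used here because these definitions have to compute. *)
Definition signed_seq_sum (s : seq bool) (m : seq nat) : int :=
  foldr (fun (p : bool * nat) v => (-1) ^+ p.1 * p.2%:Z + v) 0 (zip s m).

Definition balanced (m : seq nat) : bool :=
  has (fun s => `|signed_seq_sum s m| <= 2)
    [seq [:: p.1; p.2; q.1; q.2] |
      p <- [seq (a, b) | a <- [:: false; true], b <- [:: false; true]],
      q <- [seq (a, b) | a <- [:: false; true], b <- [:: false; true]]].

Definition lone (a b c d : nat) : bool := (2 < a)%N && (b + c + d == 0)%N.

(** There are only 5^4 candidates, which are checked one by one. *)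
Lemma balanced_or_lone (a b c d : nat) :
  (a * a + b * b + c * c + d * d <= 16)%N ->
  [|| balanced [:: a; b; c; d], lone a b c d, lone b a c d, lone c a b d
    | lone d a b c].
Proof.
have all_check : all (fun a => all (fun b => all (fun c => all (fun d =>
    (a * a + b * b + c * c + d * d <= 16)%N ==>
    [|| balanced [:: a; b; c; d], lone a b c d, lone b a c d, lone c a b d
      | lone d a b c])
  (iota 0 5)) (iota 0 5)) (iota 0 5)) (iota 0 5) by vm_compute.
move=> le16.
have small n : (n * n <= 16)%N -> n \in iota 0 5 by rewrite mem_iota; nia.
have aI : a \in iota 0 5 by apply: small; lia.
have bI : b \in iota 0 5 by apply: small; lia.
have cI : c \in iota 0 5 by apply: small; lia.
have dI : d \in iota 0 5 by apply: small; lia.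
move/allP/(_ a aI)/allP/(_ b bI)/allP/(_ c cI)/allP/(_ d dI): all_check.
by move/implyP/(_ le16).
Qed.

(** Only the absolute values matter for balancing, as a switch can absorb the
sign of the entry that it controls. *)
Lemma balance_or_concentrated (r : 'I_4 -> int) : \sum_i r i ^+ 2 <= 16 ->
  (exists x, `|dot x r| <= 2) \/
  exists2 i, `|r i| = 3 \/ `|r i| = 4 & forall j, j != i -> r j = 0.
Proof.
move=> le16.
have abs_sqr i : (`|r i| * `|r i|)%N = r i ^+ 2 :> int by lia.
have le4 i : `|r i| <= 4.
  suff: r i ^+ 2 <= 16 by nia.
  apply: le_trans le16; rewrite (bigD1 i) //= lerDl.
  by apply: sumr_ge0 => j _; exact: sqr_ge0.
have four (j : 'I_4) : [\/ j = inord 0, j = inord 1, j = inord 2 | j = inord 3].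
  case: j => -[|[|[|[|//]]]] lt.
  - by apply: Or41; apply/val_inj; rewrite /= inordK.
  - by apply: Or42; apply/val_inj; rewrite /= inordK.
  - by apply: Or43; apply/val_inj; rewrite /= inordK.
  - by apply: Or44; apply/val_inj; rewrite /= inordK.
have lone_at i : (2 < `|r i|)%N -> (forall j, j != i -> r j = 0) ->
  exists2 i, `|r i| = 3 \/ `|r i| = 4 & forall j, j != i -> r j = 0.
  by move=> gt2 r0; exists i => //; have := le4 i; lia.
have := @balanced_or_lone `|r (inord 0)| `|r (inord 1)| `|r (inord 2)|
  `|r (inord 3)|.
case/(_ _)/or4P; first by rewrite sum4 -!abs_sqr in le16; lia.
4: case/orP.
2-5: by case/andP => gt2 rest0; right; apply: (lone_at _ gt2) => j;
  case: (four j) => ->; rewrite ?eqxx // => _; lia.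
case/hasP => s /allpairsP[[[s0 s1] [s2 s3]] [_ _ /= ->]] s_le2; left.
exists (fun i : 'I_4 => nth false [:: s0; s1; s2; s3] i (+) (r i < 0)).
rewrite /dot sum4 !inordK //=.
move: s_le2; rewrite /signed_seq_sum /= !addr0 !addrA.
have abs_sign (b : bool) i :
    (-1) ^+ b * `|r i|%N%:Z = (-1) ^+ (b (+) (r i < 0)) * r i.
  by rewrite signr_addb -mulrA -normrEsign abszE.
by rewrite !abs_sign.
Qed.

(** * Balancing a 4 x 4 integer matrix *)

Definition sqnorm (C : 'I_4 -> 'I_4 -> int) : int := \sum_i \sum_j C i j ^+ 2.

Definition row_sums (C : 'I_4 -> 'I_4 -> int) (y : 'I_4 -> bool) (i : 'I_4) :=
  dot y (C i).

Lemma mean_row_sums (C : 'I_4 -> 'I_4 -> int) (u : 'I_4 -> bool) :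
  \sum_k \sum_i row_sums C (coset u k) i ^+ 2 = 4 * sqnorm C.
Proof.
by rewrite exchange_big mulr_sumr; apply: eq_bigr => i _; exact: parseval.
Qed.

(** A signed sum and its sum of squares have the same parity, whatever the
signs; so the parity of the left-hand side does not depend on [y]. *)
Lemma row_sums_parity (C : 'I_4 -> 'I_4 -> int) (y : 'I_4 -> bool) :
  exists q, \sum_i row_sums C y i ^+ 2 = sqnorm C + 2 * q.
Proof.
rewrite /sqnorm !(sum4 (fun i => _ i ^+ 2)) (sum4 (fun i => \sum_j _)).
rewrite /row_sums.
have [q0 ->] := dot_sqr_parity y (C (inord 0)).
have [q1 ->] := dot_sqr_parity y (C (inord 1)).
have [q2 ->] := dot_sqr_parity y (C (inord 2)).
have [q3 ->] := dot_sqr_parity y (C (inord 3)).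
by exists (q0 + q1 + q2 + q3); ring.
Qed.

Lemma sum_sqr_concentrated n (r : 'I_n -> int) (i : 'I_n) :
  (forall j, j != i -> r j = 0) -> \sum_j r j ^+ 2 = r i ^+ 2.
Proof.
move=> r0; rewrite (bigD1 i) //= big1 ?addr0 // => j /r0 ->.
by rewrite expr0n.
Qed.

(** Flipping a column that adds 1 or 2 to the row sum 3 and has entries at most
1 in the other rows turns the row sums into one of absolute value 1 and three
of absolute value at most 2.  Such a column exists: otherwise each column would
contribute to the row sum 3 no more than its number of entries of absolute
value 2, and there is at most one of these in the whole matrix. *)
Lemma balance_odd (C : 'I_4 -> 'I_4 -> int) (y : 'I_4 -> bool) (i : 'I_4) :
    (forall i j, `|C i j| <= 2) ->
    \sum_i \sum_j (`|C i j| == 2)%:Z <= 1 ->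
    `|row_sums C y i| = 3 -> (forall j, j != i -> row_sums C y j = 0) ->
  exists x z, `|dot x (row_sums C z)| <= 2.
Proof.
move=> C_le2 twos_le1 ri r0.
(* The contribution of column j to row sum i, once that sum is made positive. *)
pose c j := (-1) ^+ (row_sums C y i < 0)%R * ((-1) ^+ y j * C i j).
have sum_c : \sum_j c j = 3 by rewrite -mulr_sumr -ri normrEsign.
have [j lt_cj] : exists j, \sum_i (`|C i j| == 2)%:Z < c j.
  apply/existsP; case: (boolP [exists j, _]) => // /existsPn le_c.
  suff: 3 <= 1 :> int by [].
  apply: le_trans twos_le1; rewrite exchange_big -sum_c.
  by apply: ler_sum => j _; rewrite leNgt; exact: le_c.
have abs_cj : `|c j| = `|C i j| by rewrite /c !normrM !normr_sign !mul1r.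
have twos_j : \sum_i (`|C i j| == 2)%:Z <= 1.
  apply: le_trans twos_le1.
  rewrite [leRHS]exchange_big [leRHS](bigD1 j) //= lerDl.
  by apply: sumr_ge0 => k _; apply: sumr_ge0.
(* If c j = 2, the only entry 2 of column j is in row i; if c j = 1, the column
   has none. *)
have no_two k : k != i -> `|C k j| <= 1.
  move=> neq_ki; move: twos_j lt_cj.
  rewrite (bigD1 i) //= (bigD1 k) //=.
  set rest := \sum_(_ | _) _.
  have rest_ge0 : 0 <= rest by exact: sumr_ge0.
  have := C_le2 k j; have := C_le2 i j; lia.
have cj_gt0 : 0 < c j by apply: le_lt_trans lt_cj; exact: sumr_ge0.
have le2_flip k : `|row_sums C (flip y j) k| <= 2.
  have abs_Ckj : `|(-1) ^+ y j * C k j| = `|C k j|.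
    by rewrite normrM normr_sign mul1r.
  rewrite /row_sums dot_flip -/(row_sums C y k).
  have [->|neq_ki] := eqVneq k i; last first.
    by rewrite r0 //; have := no_two k neq_ki; lia.
  have := C_le2 i j; move: cj_gt0 ri; rewrite -abs_cj /c.
  set d := (-1) ^+ y j * C i j; case: (ltrP (row_sums C y i) 0) => ?;
    rewrite /= ?expr0 ?expr1; lia.
have : \sum_k row_sums C (flip y j) k ^+ 2 <= 16.
  have le4 k : row_sums C (flip y j) k ^+ 2 <= 4 by have := le2_flip k; nia.
  rewrite sum4.
  move: (le4 (inord 0)) (le4 (inord 1)) (le4 (inord 2)) (le4 (inord 3)); lia.
case/balance_or_concentrated => [[x le2]|]; first by exists x, (flip y j).
by case=> k + _; have := le2_flip k; lia.
Qed.

(** The mean of the sums of squares over a coset is at most 16, and a single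
sum below 16 yields a balanced setting, as 9 has the wrong parity.  So
otherwise all sums equal 16 and all row sums are multiples of 4, both before and
after flipping column [j]; yet row sum [k] changes by twice the odd [C k j]. *)
Lemma balance_even (C : 'I_4 -> 'I_4 -> int) (y : 'I_4 -> bool) (i k j : 'I_4) :
    sqnorm C <= 16 -> odd `|C k j| ->
    `|row_sums C y i| = 4 -> (forall j, j != i -> row_sums C y j = 0) ->
  exists x z, `|dot x (row_sums C z)| <= 2.
Proof.
move=> C_le16 Ckj_odd ri r0.
have [n norm_even] : exists n, sqnorm C = 2 * n.
  have [q] := row_sums_parity C y; rewrite (sum_sqr_concentrated r0) => e.
  by exists (8 - q); lia.
have concentrated4 z : \sum_i row_sums C z i ^+ 2 <= 16 ->
  (exists x, `|dot x (row_sums C z)| <= 2) \/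
  \sum_i row_sums C z i ^+ 2 = 16 /\ forall i, exists q, row_sums C z i = 4 * q.
  case/balance_or_concentrated => [|[l rl rz]]; [by left | right].
  have [q'] := row_sums_parity C z.
  rewrite norm_even (sum_sqr_concentrated rz) => e.
  have {}rl : `|row_sums C z l| = 4 by nia.
  split=> [|m]; first by nia.
  have [->|/rz->] := eqVneq m l; last by exists 0.
  by case: (lerP 0 (row_sums C z l)) => ?; [exists 1 | exists (- 1)]; lia.
have [|[x le2]|[_ /(_ k)[a ra]]] := @concentrated4 y _.
- by rewrite (sum_sqr_concentrated r0); nia.
- by exists x, y.
have mean := mean_row_sums C (flip y j).
have [/existsP[l lt16]|/existsPn ge16] :=
  boolP [exists l, \sum_i row_sums C (coset (flip y j) l) i ^+ 2 < 16].
  have [[x le2]|[e _]] := concentrated4 _ (ltW lt16); last first.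
    by rewrite e in lt16.
  by exists x, (coset (flip y j) l).
have [|[x le2]|[_ /(_ k)[b rb]]] := @concentrated4 (flip y j) _.
- have -> : \sum_i row_sums C (flip y j) i ^+ 2
      = \sum_i row_sums C (coset (flip y j) (inord 0)) i ^+ 2.
    apply: eq_bigr => l _; congr (_ ^+ 2); apply: eq_bigr => m _.
    by rewrite /coset /hadamard inordK //= addbF.
  move: mean; rewrite sum4.
  move: (ge16 (inord 0)) (ge16 (inord 1)) (ge16 (inord 2)) (ge16 (inord 3)).
  move: C_le16; lia.
- by exists x, (flip y j).
move: rb; rewrite /row_sums dot_flip -/(row_sums C y k) ra.
by move: Ckj_odd; case: (y j) => /=; rewrite ?expr0 ?expr1; lia.
Qed.

Lemma balance_matrix (C : 'I_4 -> 'I_4 -> int) :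
    (forall i j, `|C i j| <= 2) -> sqnorm C <= 16 ->
    8 <= \sum_i \sum_j (odd `|C i j|)%:Z ->
  exists x y, `|dot x (row_sums C y)| <= 2.
Proof.
move=> C_le2 C_le16 odd_ge8.
have [|k le16] := @exists_le_mean
    (fun k => \sum_i row_sums C (coset (fun=> false) k) i ^+ 2) 16.
  by rewrite mean_row_sums ler_pM2l.
set y := coset _ k in le16.
have [[x le2]|[i [ri|ri] r0]] := balance_or_concentrated le16.
- by exists x, y.
- apply: (balance_odd _ _ ri r0) => //.
  have [q] := row_sums_parity C y; rewrite (sum_sqr_concentrated r0) => e.
  have : \sum_i \sum_j (odd `|C i j|)%:Z
      + 4 * \sum_i \sum_j (`|C i j| == 2)%:Z <= sqnorm C.
    rewrite mulr_sumr -big_split /=; apply: ler_sum => k' _.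
    rewrite mulr_sumr -big_split /=; apply: ler_sum => j _.
    by have := C_le2 k' j; nia.
  by nia.
- have [k' /existsP[j Codd]] : exists k, [exists j, odd `|C k j|].
    apply/existsP; case: (boolP [exists k, _]) => // /existsPn even_C.
    move: odd_ge8; rewrite big1 // => k' _; rewrite big1 // => j _.
    by have /existsPn/(_ j)/negPf-> := even_C k'.
  exact: balance_even C_le16 Codd ri r0.
Qed.

(** * Collapsing the cube along its lines *)

(** Half the signed sum of a line, see [dot_sign]: a light contributes -1
exactly when [s] and [a] disagree, which brings 4 down by 2. *)
Definition half_line (s a : 'I_4 -> bool) : int :=
  2 - (\sum_k (s k (+) a k))%N%:Z.

Definition sign (b : bool) : int := (-1) ^+ b.

Lemma dot_sign (s a : 'I_4 -> bool) :
  dot s (fun k => sign (a k)) = 2 * half_line s a.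
Proof.
rewrite /dot /half_line /sign !sum4.
by do 4!case: (s _) => /=; do 4!case: (a _) => /=.
Qed.

Lemma half_line_le2 (s a : 'I_4 -> bool) : `|half_line s a| <= 2.
Proof. by rewrite /half_line sum4; lia. Qed.

Lemma odd_half_line (s a : 'I_4 -> bool) :
  odd `|half_line s a| = odd (\sum_k s k) (+) odd (\sum_k a k).
Proof.
have -> : odd `|half_line s a| = odd (\sum_k (s k (+) a k))%N.
  by rewrite /half_line; set m := (\sum_k _)%N; lia.
rewrite !sum4 !oddD !oddb.
by do 4!case: (s _); do 4!case: (a _).
Qed.

(** Every row of the Hadamard matrix has an even number of -1. *)
Lemma odd_coset (u : 'I_4 -> bool) k :
  odd (\sum_j coset u k j) = odd (\sum_j u j).
Proof.
rewrite /coset !sum4 /hadamard !inordK // !oddD.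
by case: (odd k); case: (1 < k)%N; do 4!case: (u _).
Qed.

Lemma mean_half_line (u a : 'I_4 -> bool) :
  \sum_k half_line (coset u k) a ^+ 2 = 4.
Proof.
have := parseval u (fun k => sign (a k)).
under eq_bigr do rewrite dot_sign exprMn.
under [in RHS]eq_bigr do rewrite sqrr_sign.
by rewrite -mulr_sumr [X in _ = 4 * X]sum4 => h; exact: (@mulfI _ 4).
Qed.

Lemma balance_bits (a : 'I_4 -> 'I_4 -> 'I_4 -> bool) :
  exists x y z : 'I_4 -> bool,
    `|\sum_i \sum_j \sum_k
        sign (x i) * sign (y j) * sign (z k) * sign (a i j k)| <= 4.
Proof.
(* For z with an odd number of thrown switches iff b holds, this is the number
   of odd entries of C. *)
pose odd_lines (b : bool) := \sum_i \sum_j (b (+) odd (\sum_k a i j k)%N)%:Z.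
have [b ge8] : exists b, 8 <= odd_lines b.
  have : odd_lines true + odd_lines false = 16.
    have one_of (c : bool) : (true (+) c)%:Z + (false (+) c)%:Z = 1 by case: c.
    rewrite -big_split (eq_bigr (fun=> 4)) ?sum4 // => i _.
    rewrite -big_split (eq_bigr (fun=> 1)) ?sum4 // => j _.
    exact: one_of.
  by case: (lerP 8 (odd_lines true)) => ?; [exists true | exists false]; lia.
pose u := (fun k : 'I_4 => (k == inord 0) && b).
have odd_u : odd (\sum_j u j) = b.
  by rewrite (bigD1 (inord 0)) //= big1 ?addn0 /u ?eqxx ?oddb // => j /negPf->.
pose C k i j := half_line (coset u k) (a i j).
have [|k C_le16] := @exists_le_mean (fun k => sqnorm (C k)) 16.
  rewrite exchange_big; under eq_bigr do rewrite exchange_big.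
  by under eq_bigr do under eq_bigr do rewrite mean_half_line; rewrite !sum4.
have [|||x [y le2]] := @balance_matrix (C k) => //.
- by move=> i j; exact: half_line_le2.
- congr (_ <= _): ge8; apply: eq_bigr => i _; apply: eq_bigr => j _.
  by rewrite odd_half_line odd_coset odd_u.
exists x, y, (coset u k).
have -> : \sum_i \sum_j \sum_l
    sign (x i) * sign (y j) * sign (coset u k l) * sign (a i j l)
    = 2 * dot x (row_sums (C k) y).
  rewrite mulr_sumr; apply: eq_bigr => i _.
  rewrite mulrCA mulr_sumr mulr_sumr; apply: eq_bigr => j _.
  rewrite [2 * _]mulrCA -[2 * _]dot_sign mulr_sumr mulr_sumr.
  apply: eq_bigr => l _.
  by rewrite !mulrA.
by lia.
Qed.

Lemma sign_in (b : bool) : sign b \in [:: 1 : int; -1].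
Proof. by case: b. Qed.

Definition light (b : bool) : pm1 := SeqSub (sign_in b).

Lemma pm1_sign (v : pm1) : val v = sign (val v == -1).
Proof. by case: v => v /=; rewrite !inE => /orP[]/eqP->. Qed.

Lemma switches_sign n (v : switches n) :
  exists b : 'I_n -> bool, forall i, val (v i) = sign (b i).
Proof. by exists (fun i => val (v i) == -1) => i; exact: pm1_sign. Qed.

Lemma attainable_4 : attainable 4 4.
Proof.
apply/forallP => A.
have [x [y [z le4]]] := balance_bits (fun i j k => val (A (i, j, k)) == -1).
apply/existsP; exists [ffun i => light (x i)].
apply/existsP; exists [ffun j => light (y j)].
apply/existsP; exists [ffun k => light (z k)].
rewrite /imbalance.
under eq_bigr do under eq_bigr do under eq_bigr do
  rewrite !ffunE [val (A _)]pm1_sign.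
by rewrite -lez_nat abszE.
Qed.

(** * A cube that cannot be balanced below 4 *)

(** Each of the coordinates 0, 1, 2 occurs exactly twice in each of the three
directions. *)
Definition six_lights : seq ('I_4 * 'I_4 * 'I_4) :=
  let o i (lt_i4 : (i < 4)%N) := Ordinal lt_i4 in
  let o0 := o 0 isT in let o1 := o 1 isT in let o2 := o 2 isT in
  [:: (o0, o0, o1); (o0, o2, o0); (o1, o0, o2);
      (o1, o1, o0); (o2, o1, o1); (o2, o2, o2)].

Definition hard_state : state 4 := [ffun p => light (p \in six_lights)].

(** In the product of the six signs x_i y_j z_k over [six_lights] every switch
occurs twice, so the product is 1, an even number of the signs are -1, and
their sum is 2 modulo 4. *)
Lemma imbalance_hard_state (x y z : switches 4) :
  (4 <= imbalance hard_state x y z)%N.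
Proof.
rewrite /imbalance.
set S := \sum_i _.
pose F p := val (x p.1.1) * val (y p.1.2) * val (z p.2).
pose T : int := \sum_(p <- six_lights) F p.
pose total (v : switches 4) := \sum_i val (v i).
have S_T : S = total x * total y * total z - 2 * T.
  have -> : total x * total y * total z = \sum_p F p.
    rewrite -(pair_bigA _ (fun p k => F (p, k))).
    rewrite -(pair_bigA _ (fun i j => \sum_k F (i, j, k))) /= /total.
    rewrite -mulrA mulr_suml; apply: eq_bigr => i _.
    rewrite mulr_suml mulr_sumr; apply: eq_bigr => j _.
    by rewrite mulr_sumr mulr_sumr; apply: eq_bigr => k _; rewrite mulrA.
  have -> : S = \sum_p F p * val (hard_state p).
    by rewrite /S !pair_bigA; apply: eq_bigr => -[[i j] k].
  have -> : T = \sum_p (if p \in six_lights then F p else 0).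
    by rewrite -big_mkcond -big_uniq.
  rewrite mulr_sumr -sumrB.
  apply: eq_bigr => p _; rewrite ffunE /= /sign.
  by case: (p \in _); rewrite /= ?expr0 ?expr1; ring.
have sum_even (v : switches 4) : exists q, total v = 2 * q.
  have [b vE] := switches_sign v; exists (half_line (fun=> false) b).
  by rewrite -dot_sign; apply: eq_bigr => i _; rewrite expr0 mul1r.
have [m T_m] : exists m, T = 4 * m + 2.
  have prod_signs (a b c d e f : bool) : f = a (+) b (+) c (+) d (+) e ->
      exists m, sign a + sign b + sign c + sign d + sign e + sign f = 4 * m + 2.
    by move->; case: a; case: b; case: c; case: d; case: e;
      solve [by exists 1 | by exists 0 | by exists (- 1) | by exists (- 2)].
  rewrite /T /six_lights !big_cons big_nil /F /= addr0 !addrA.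
  have [xb xE] := switches_sign x.
  have [yb yE] := switches_sign y.
  have [zb zE] := switches_sign z.
  rewrite !xE !yE !zE /sign -!signr_addb; apply: prod_signs.
  by do 3!case: (xb _); do 3!case: (yb _); do 3!case: (zb _).
have [p ex] := sum_even x; have [q ey] := sum_even y; have [r ez] := sum_even z.
rewrite S_T T_m ex ey ez; nia.
Qed.

Theorem theorem3 : P 4 = 4%N.
Proof.
rewrite /P; case: ex_minnP => p p_att p_min; apply/eqP.
rewrite eqn_leq p_min ?attainable_4 //=.
have /forallP/(_ hard_state)/existsP[x /existsP[y /existsP[z le_p]]] := p_att.
exact: leq_trans (imbalance_hard_state x y z) le_p.
Qed.
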